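(* For every integer $d\ge 2$ and every $n\in\mathbb{N}$, \[ |S_{I^d_2}(n)| \ge \frac{1}{en}\, e^{-(1+1/(d-1))n}\,(n!)^{d-1-1/(d-1)}. \]
   Context: A $d$-dimensional binary matrix of size $n\times\cdots\times n$ is an element of $\{0,1\}^{[n]^d}$. It is a $d$-dimensional $n$-permutation matrix if it has exactly $n$ $1$-entries and any two distinct $1$-entries differ in every coordinate. A $d$-dimensional binary matrix $P$ of size $k_1\times\cdots\times k_d$ is contained in $A$ of size $n_1\times\cdots\times n_d$ if there are increasing injections $f_i:[k_i]\to[n_i]$ with $p_{i_1,\dots,i_d}=1\Rightarrow a_{f_1(i_1),\dots,f_d(i_d)}=1$; otherwise $A$ avoids $P$. $S_P(n)$ is the set of $d$-dimensional $n$-permutation matrices avoiding $P$. $I^d_k$ is the $d$-dimensional $k$-permutation matrix with $1$-entries at $(i,i,\dots,i)$ for $i\in[k]$. *)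

(* Defs.v *)
From mathcomp Require Import all_boot all_order all_algebra.
From mathcomp Require Import all_classical all_reals all_analysis.

Set Implicit Arguments.
Unset Strict Implicit.
Unset Printing Implicit Defensive.

Local Open Scope nat_scope.

(* Positions in a d-dimensional array of size k 0 x ... x k (d-1).
   Coordinates and entries are numbered from 0. *)
Definition position (d : nat) (k : 'I_d -> nat) : Type :=
  {dffun forall i : 'I_d, 'I_(k i)}.

Definition binmx (d : nat) (k : 'I_d -> nat) : Type :=
  {ffun position k -> bool}.

Definition cube (d n : nat) : 'I_d -> nat := fun=> n.
Arguments cube : clear implicits.

Definition is_permmx (d n : nat) (A : binmx (cube d n)) : bool :=
  (#|[set x | A x]| == n) &&
  [forall x, forall y,
     [&& A x, A y & x != y] ==> [forall i : 'I_d, x i != y i]].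

(* Strictly increasing maps, hence injective. *)
Definition increasing (m n : nat) (f : {ffun 'I_m -> 'I_n}) : bool :=
  [forall a : 'I_m, forall b : 'I_m, (a < b) ==> (f a < f b)].

Definition embed_position (d : nat) (k n : 'I_d -> nat)
    (f : {dffun forall i : 'I_d, {ffun 'I_(k i) -> 'I_(n i)}})
    (x : position k) : position n :=
  [ffun i => f i (x i)].

Definition contains (d : nat) (k n : 'I_d -> nat)
    (P : binmx k) (A : binmx n) : bool :=
  [exists f : {dffun forall i : 'I_d, {ffun 'I_(k i) -> 'I_(n i)}},
     [forall i, increasing (f i)] &&
     [forall x : position k, P x ==> A (embed_position f x)]].

Definition avoiders (d : nat) (k : 'I_d -> nat) (P : binmx k) (n : nat) :
    {set binmx (cube d n)} :=
  [set A | is_permmx A && ~~ contains P A].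

Definition idpermmx (d k : nat) : binmx (cube d k) :=
  [ffun x : position (cube d k) =>
     [exists j : 'I_k, [forall i : 'I_d, x i == j]]].

(* Main.v *)
Require Import Defs.
From mathcomp Require Import all_boot all_order all_fingroup all_algebra.
From mathcomp Require Import all_classical all_reals all_analysis.
From mathcomp Require Import ring lra.
Import Order.TTheory GRing.Theory Num.Theory.
Local Open Scope nat_scope.

(* Put k = d - 1.  A d-dimensional permutation matrix is the point set
   (i, t i, s_1 i, ..., s_(k-1) i) for permutations t, s_1, ..., s_(k-1), and it
   avoids I_2 iff t reverses the strict order induced on indices by the s_j.
   By a union bound, all but a fraction 1/e of the tuples s have no chain of
   length more than L = floor(e n^(1/k)): a given set of l indices is a chain
   with probability 1/(l!)^(k-1).  If there is no such chain, the height
   function has at most L levels, and at least n!/L^n permutations t reverse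
   its levels.  Hence there are at least
   (1 - 1/e) (n!)^(k-1) n! / (e n^(1/k))^n avoiders, and n^n <= n! e^n turns
   this into the claim. *)

Set Implicit Arguments.
Unset Strict Implicit.
Unset Printing Implicit Defensive.

(** * Permutations increasing on a set, and the union bound for chains *)

Definition incr_on {n : nat} (T : {set 'I_n}) (s : 'S_n) : bool :=
  [forall x in T, forall y in T, (x < y) ==> (s x < s y)].

Lemma incr_onP {n : nat} (T : {set 'I_n}) (s : 'S_n) :
  reflect (forall x y, x \in T -> y \in T -> x < y -> s x < s y) (incr_on T s).
Proof.
apply: (iffP forall_inP) => [H x y xT yT xy|H x xT].
  by have /forall_inP/(_ y yT)/implyP := H x xT; apply.
by apply/forall_inP => y yT; apply/implyP; apply: H.
Qed.

(** Strong induction on [x] in [T], all smaller points being fixed: [u x < x] contradicts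
    injectivity, and if [u x > x] then the preimage of [x] lies above [x], against monotonicity on
    [T]. *)
Lemma perm_on_incr1 {n : nat} (T : {set 'I_n}) (u : 'S_n) :
  perm_on T u -> incr_on T u -> u = 1%g.
Proof.
move=> uT /incr_onP ui; apply/permP => x; rewrite perm1.
have [m] := ubnP (x : nat); elim: m x => // m IH x; rewrite ltnS => xm.
have fixlt (z : 'I_n) : z < x -> u z = z by move=> zx; apply: IH; apply: leq_trans xm.
have [xT|xT] := boolP (x \in T); last by apply: out_perm uT xT.
have uxT : u x \in T by rewrite perm_closed.
case: (ltngtP (u x) x) => [lt|gt|/val_inj//].
  by apply: (@perm_inj _ u); apply: fixlt.
set y := (u^-1)%g x; have uy : u y = x by rewrite permKV.
have yT : y \in T by rewrite -(perm_closed y uT) uy.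
case: (ltngtP y x) => [lt|lt|/val_inj e].
- by move: (lt); rewrite -(fixlt _ lt) uy ltnn.
- by have := ui _ _ xT yT lt; rewrite uy => /(ltn_trans gt); rewrite ltnn.
- by rewrite -{1}e uy.
Qed.

(** Rearranging each increasing [s] by the permutations supported on [T] never produces the same
    product twice: two factorisations of one product differ by a [u] that is supported on [T] and
    increasing there, so [u = 1]. *)
Lemma card_incr_on {n : nat} (T : {set 'I_n}) :
  #|[set s : 'S_n | incr_on T s]| * (#|T|)`! <= n`!.
Proof.
pose X := finset.setX [set s | incr_on T s] [set t | perm_on T t].
have -> : #|[set s | incr_on T s]| * (#|T|)`! = #|X|.
  by rewrite /X cardsX [X in _ = _ * X]cardsE card_perm.
rewrite -card_Sn.
have inj : {in X &, injective (fun st : 'S_n * 'S_n => (st.2 * st.1)%g)}.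
  move=> [s t] [s' t']; rewrite !inE /= => /andP[/incr_onP is_ pt].
  move=> /andP[/incr_onP is' pt'] e.
  have e' : (t'^-1 * t * s = s')%g by rewrite -mulgA e mulKg.
  set u := (t'^-1 * t)%g in e'.
  have pu : perm_on T u by rewrite /u perm_onM // perm_onV.
  have u1 : u = 1%g.
    apply: (perm_on_incr1 pu); apply/incr_onP => x y xT yT xy.
    have := is' _ _ xT yT xy; rewrite -e' !(permM u) => lt.
    case: (ltngtP (u x) (u y)) => [//|gt|euxy].
      have := is_ (u y) (u x); rewrite !perm_closed // => /(_ yT xT gt).
      by move=> /(ltn_trans lt); rewrite ltnn.
    have exy : x = y by apply/(@perm_inj _ u)/val_inj.
    by rewrite exy ltnn in xy.
  have -> : s = s' by rewrite -e' u1 mul1g.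
  by have -> : t = t' by apply/esym/eqP; rewrite eq_mulVg1; apply/eqP.
by rewrite -(card_in_imset inj) max_card.
Qed.

Definition has_chain {n p : nat} (l : nat) (s : {ffun 'I_p -> 'S_n}) : bool :=
  [exists T : {set 'I_n}, (#|T| == l) && [forall i, incr_on T (s i)]].

(** Union bound over the [l]-subsets [T]: the [p] components are chosen independently, so each [T]
    accounts for at most (n!/l!)^p tuples. *)
Lemma card_has_chain (n p l : nat) :
  #|[set s : {ffun 'I_p -> 'S_n} | has_chain l s]| * l`! ^ p
    <= 'C(n, l) * n`! ^ p.
Proof.
pose F (T : {set 'I_n}) := [set s : {ffun 'I_p -> 'S_n} | [forall i, incr_on T (s i)]].
have cF (T : {set 'I_n}) : #|T| == l -> #|F T| * l`! ^ p <= n`! ^ p.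
  move=> /eqP <-; have -> : #|F T| = #|[set s : 'S_n | incr_on T s]| ^ p.
    rewrite -[p in RHS]card_ord -card_ffun_on; apply: eq_card => s; rewrite !inE.
    by apply/forallP/ffun_onP => H i; have := H i; rewrite inE.
  have mono a b q : a <= b -> a ^ q <= b ^ q by case: q => // q; rewrite leq_exp2r.
  by rewrite -expnMn; apply/mono/card_incr_on.
have -> : [set s : {ffun 'I_p -> 'S_n} | has_chain l s]
    = \bigcup_(T : {set 'I_n} | #|T| == l) F T.
  apply/setP => s; rewrite inE; apply/existsP/finset.bigcupP.
    by move=> [T /andP[Tl H]]; exists T => //; rewrite inE.
  by move=> [T Tl]; rewrite inE => H; exists T; rewrite Tl.
have le : #|\bigcup_(T : {set 'I_n} | #|T| == l) F T| <=
    \sum_(T : {set 'I_n} | #|T| == l) #|F T|.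
  elim/big_rec2: _ => [|T a B _ IH]; first by rewrite cards0.
  by rewrite (leq_trans (leq_card_setU _ _)) // leq_add2l.
apply: leq_trans (leq_mul le (leqnn _)) _; rewrite big_distrl /=.
apply: leq_trans (leq_sum _ cF) _.
by rewrite sum_nat_const -[n in 'C(n, _)]card_ord -card_draws cardsE.
Qed.

(** * Height functions of tuples without long chains *)

Definition dominated {n p : nat} (s : {ffun 'I_p -> 'S_n}) (x y : 'I_n) : bool :=
  (x < y) && [forall i, s i x < s i y].

(** The height of [x] is one less than the size of a longest chain with top element [x]. If [y]
    dominates [x], then [y] can be put on top of such a chain. *)
Lemma level_function (n p L : nat) (s : {ffun 'I_p -> 'S_n}) :
  0 < L -> ~~ has_chain L.+1 s ->
  exists h : 'I_n -> 'I_L, forall x y, dominated s x y -> h x < h y.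
Proof.
(* From here on there are [L.+1] levels, heights run from 0 to [L], and the forbidden chains have
   [L.+2] elements. *)
case: L => // L _ nc.
pose good (x : 'I_n) (T : {set 'I_n}) :=
  [&& x \in T, [forall i, incr_on T (s i)] & [forall y in T, y <= x]].
pose h x := \max_(T : {set 'I_n} | good x T) #|T :\ x|.
have hle x : h x <= L.
  apply/bigmax_leqP => T /and3P[xT /forallP cT _].
  rewrite leqNgt; apply: contra nc => lt.
  have : L.+2 <= #|T| by rewrite (cardsD1 x) xT.
  rewrite cardE => le.
  (* [has_chain] asks for an exact size, so a chain that is too long is truncated. *)
  have u : uniq (take L.+2 (enum T)) by rewrite take_uniq // enum_uniq.
  have sub z : z \in take L.+2 (enum T) -> z \in T.
    by move=> /mem_take; rewrite mem_enum.
  apply/existsP; exists [set z in take L.+2 (enum T)]; apply/andP; split.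
    by rewrite cardsE (card_uniqP u) size_takel.
  apply/forallP => i; apply/incr_onP => a b; rewrite !inE => /sub aT /sub bT.
  exact: (@incr_onP _ T (s i) (cT i)).
exists (fun x => inord (h x)) => x y /andP[xy /forallP sxy].
rewrite !inordK ?ltnS //.
(* The singleton makes the family of chains nonempty, so the maximum is attained by some [T]. *)
have g1 : good x [set x].
  rewrite /good set11 /=; apply/andP; split.
    by apply/forallP => i; apply/incr_onP => a b /set1P -> /set1P ->; rewrite ltnn.
  by apply/forall_inP => a /set1P ->.
have [T gT eT] := eq_bigmax_cond (fun T : {set 'I_n} => #|T :\ x|)
  (A := [pred T | good x T]) ltac:(by apply/card_gt0P; exists [set x]).
have -> : h x = #|T :\ x| by rewrite -eT.
move: gT => /and3P[xT /forallP cT /forall_inP mT].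
have yT : y \notin T by apply/negP => /mT; rewrite leqNgt xy.
have -> : #|T :\ x|.+1 = #|(y |: T) :\ y|.
  by rewrite setU1K // [RHS](cardsD1 x) xT.
apply: (@leq_bigmax_cond _ (good y) (fun T : {set 'I_n} => #|T :\ y|)).
rewrite /good setU11 /=; apply/andP; split.
  apply/forallP => i; apply/incr_onP => a b.
  move=> /setU1P[->|aT] /setU1P[->|bT]; first by rewrite ltnn.
  - by move=> /ltn_trans/(_ (leq_ltn_trans (mT _ bT) xy)); rewrite ltnn.
  - move=> _; have := mT _ aT; rewrite leq_eqVlt => /orP[/eqP/val_inj -> //|ax].
    exact: ltn_trans (@incr_onP _ T (s i) (cT i) _ _ aT xT ax) (sxy i).
  - exact: (@incr_onP _ T (s i) (cT i)).
by apply/forall_inP => a /setU1P[->//|/mT/leq_trans]; apply; apply: ltnW.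
Qed.

(** * Permutations reversing the levels of a function *)

(** List the indices by decreasing [h] and send each one to its rank in the list. *)
Lemma exists_sorting_perm (n L : nat) (h : 'I_n -> 'I_L) :
  exists r : 'S_n, forall x y, h x < h y -> r y < r x.
Proof.
pose e := sort (fun x y => h y <= h x) (enum 'I_n).
have se : size e = n by rewrite size_sort size_enum_ord.
have ie x : x \in e by rewrite mem_sort mem_enum.
have lt x : index x e < n by rewrite -[X in _ < X]se index_mem.
have inj : injective (fun x => Ordinal (lt x)).
  move=> x y /(congr1 val) /= exy.
  by rewrite -(nth_index x (ie x)) exy nth_index.
exists (perm inj) => x y hxy; rewrite !permE /= ltnNge; apply/negP => le.
have so : sorted (fun x y : 'I_n => h y <= h x) e.
  by apply: sort_sorted => a b; apply: leq_total.
have := sorted_leq_index (leT := fun x y : 'I_n => h y <= h x) _ _ so.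
move=> /(_ _ _ x y (ie x) (ie y) le); rewrite leqNgt hxy => H.
suff : false by [].
apply: H => [a b c ab bc|a]; [exact: leq_trans bc ab|exact: leqnn].
Qed.

(* The permutations reversing the levels of h contain a coset of the
   stabiliser of h, and the orbit of h has at most L ^ n elements. *)
Lemma card_level_reversing (n L : nat) (h : 'I_n -> 'I_L) :
  n`! <= #|[set t : 'S_n | [forall x, forall y, (h x < h y) ==> (t y < t x)]]|
           * L ^ n.
Proof.
pose S := [set g : 'S_n | [forall x, h (g x) == h x]].
have [r hr] := exists_sorting_perm h.
have le1 : #|S| <= #|[set t : 'S_n |
    [forall x, forall y, (h x < h y) ==> (t y < t x)]]|.
  rewrite -(card_imset (mem S) (@mulIg _ r)); apply: subset_leq_card.
  apply/fintype.subsetP => t /imsetP[g gS0 ->]; move: gS0; rewrite !inE => /forallP gS.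
  apply/forallP => x; apply/forallP => y; apply/implyP => hxy.
  by rewrite !permM; apply: hr; rewrite !(eqP (gS _)).
apply: leq_trans (leq_mul le1 (leqnn _)).
pose f (g : 'S_n) : {ffun 'I_n -> 'I_L} := [ffun x => h (g x)].
have fib w : #|[set g | f g == w]| <= #|S|.
  have [->|[g0]] := set_0Vmem [set g | f g == w]; first by rewrite cards0.
  rewrite inE => /eqP <-.
  rewrite -(card_imset _ (@mulgI _ g0^-1%g)); apply: subset_leq_card.
  apply/fintype.subsetP => t /imsetP[g]; rewrite inE => /eqP /ffunP e ->.
  rewrite inE; apply/forallP => x; rewrite permM.
  by have := e ((g0^-1)%g x); rewrite !ffunE permKV => ->.
have -> : n`! = \sum_(w : {ffun 'I_n -> 'I_L}) #|[set g | f g == w]|.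
  rewrite -card_Sn -sum1_card (partition_big f predT) //=.
  by apply: eq_bigr => w _; rewrite sum1dep_card.
have -> : #|S| * L ^ n = \sum_(w : {ffun 'I_n -> 'I_L}) #|S|.
  by rewrite sum_nat_const card_ffun !card_ord mulnC.
by apply: leq_sum => w _; apply: fib.
Qed.

(** * Permutation matrices built from tuples of permutations *)

(** The dimension is [p.+2], so [p] is k - 1. With the identity in coordinate 0, the index of an
    entry can be read off the entry, which makes [permmx_of] injective. *)
Definition coord_perm (n p : nat) (s : {ffun 'I_p -> 'S_n}) (t : 'S_n)
    (j : 'I_p.+2) : 'S_n :=
  if unlift ord0 j is Some j' then
    if unlift ord0 j' is Some i then s i else t
  else 1%g.

Lemma coord_perm0 (n p : nat) (s : {ffun 'I_p -> 'S_n}) (t : 'S_n) :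
  coord_perm s t ord0 = 1%g.
Proof. by rewrite /coord_perm unlift_none. Qed.

Lemma coord_perm1 (n p : nat) (s : {ffun 'I_p -> 'S_n}) (t : 'S_n) :
  coord_perm s t (lift ord0 ord0) = t.
Proof. by rewrite /coord_perm liftK unlift_none. Qed.

Lemma coord_perm2 (n p : nat) (s : {ffun 'I_p -> 'S_n}) (t : 'S_n) (i : 'I_p) :
  coord_perm s t (lift ord0 (lift ord0 i)) = s i.
Proof. by rewrite /coord_perm !liftK. Qed.

Definition perm_point (n p : nat) (s : {ffun 'I_p -> 'S_n}) (t : 'S_n)
    (i : 'I_n) : position (cube p.+2 n) :=
  [ffun j => coord_perm s t j i].

Definition permmx_of (n p : nat) (st : {ffun 'I_p -> 'S_n} * 'S_n) :
    binmx (cube p.+2 n) :=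
  [ffun x => [exists i, x == perm_point st.1 st.2 i]].

Lemma permmx_of_point (n p : nat) (s : {ffun 'I_p -> 'S_n}) (t : 'S_n)
    (i : 'I_n) : permmx_of (s, t) (perm_point s t i).
Proof. by rewrite ffunE; apply/existsP; exists i. Qed.

Lemma permmx_ofP (n p : nat) (s : {ffun 'I_p -> 'S_n}) (t : 'S_n)
    (x : position (cube p.+2 n)) :
  permmx_of (s, t) x -> exists i, x = perm_point s t i.
Proof. by rewrite ffunE => /existsP[i /eqP ->]; exists i. Qed.

Lemma perm_point_inj (n p : nat) (s : {ffun 'I_p -> 'S_n}) (t : 'S_n) :
  injective (perm_point s t).
Proof.
by move=> i i' /ffunP/(_ ord0); rewrite !ffunE coord_perm0 !perm1.
Qed.

Lemma permmx_of_inj (n p : nat) : injective (@permmx_of n p).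
Proof.
move=> [s t] [s' t'] e.
have E i : perm_point s t i = perm_point s' t' i.
  have := permmx_of_point s t i; rewrite e => /permmx_ofP[i' e'].
  rewrite e'; congr perm_point; have /ffunP/(_ ord0) := e'.
  by rewrite !ffunE !coord_perm0 !perm1.
have C j : coord_perm s t j = coord_perm s' t' j.
  by apply/permP => i; have /ffunP/(_ j) := E i; rewrite !ffunE.
congr pair; last by have := C (lift ord0 ord0); rewrite !coord_perm1.
by apply/ffunP => i; have := C (lift ord0 (lift ord0 i)); rewrite !coord_perm2.
Qed.

Lemma permmx_of_is_permmx (n p : nat) (st : {ffun 'I_p -> 'S_n} * 'S_n) :
  is_permmx (permmx_of st).
Proof.
case: st => s t; apply/andP; split.
  have -> : [set x | permmx_of (s, t) x] = [set perm_point s t i | i : 'I_n].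
    apply/setP => x; rewrite inE; apply/idP/finset.imsetP.
      by move=> /permmx_ofP[i ->]; exists i.
    by move=> [i _ ->]; apply: permmx_of_point.
  by rewrite card_imset ?card_ord //; apply: perm_point_inj.
apply/forallP => x; apply/forallP => y; apply/implyP => /and3P[].
move=> /permmx_ofP[i ->] /permmx_ofP[i' ->] ne; apply/forallP => j.
rewrite !ffunE; apply: contraNneq ne => /perm_inj ->; exact: eqxx.
Qed.

(** A copy of I_2 yields indices [i], [i'] whose entries increase in every coordinate. Coordinate 1
    gives [t i < t i'], while the others say that [i'] dominates [i]. *)
Lemma permmx_of_avoids (n p : nat) (s : {ffun 'I_p -> 'S_n}) (t : 'S_n) :
  (forall x y, dominated s x y -> t y < t x) ->
  permmx_of (s, t) \in avoiders (idpermmx p.+2 2) n.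
Proof.
move=> H; rewrite inE permmx_of_is_permmx /=; apply/negP.
move=> /existsP[f /andP[/forallP fi /forallP fA]].
pose diag (a : 'I_2) : position (cube p.+2 2) := [ffun => a].
have ex a : exists i, embed_position f (diag a) = perm_point s t i.
  apply: permmx_ofP; apply: (implyP (fA _)).
  by rewrite ffunE; apply/existsP; exists a; apply/forallP => j; rewrite ffunE.
have [i ei] := ex ord0; have [i' ei'] := ex (lift ord0 ord0).
have lt j : coord_perm s t j i < coord_perm s t j i'.
  have /forallP/(_ ord0)/forallP/(_ (lift ord0 ord0))/implyP/(_ isT) := fi j.
  have /ffunP/(_ j) := ei; have /ffunP/(_ j) := ei'.
  by rewrite !ffunE => <- <-.
have dom : dominated s i i'.
  apply/andP; split; first by have := lt ord0; rewrite coord_perm0 !perm1.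
  by apply/forallP => l; have := lt (lift ord0 (lift ord0 l)); rewrite coord_perm2.
have := lt (lift ord0 ord0); rewrite coord_perm1 => /ltn_trans/(_ (H _ _ dom)).
by rewrite ltnn.
Qed.

(** * Counting avoiders and tuples with a chain *)

(** For each chain-free [s], a [t] that reverses the levels of its height function also reverses
    domination, so at least n!/L^n choices of [t] complete [s]. *)
Lemma card_avoiders_ge (n p L : nat) :
  0 < L ->
  #|[set s : {ffun 'I_p -> 'S_n} | ~~ has_chain L.+1 s]| * n`!
    <= #|avoiders (idpermmx p.+2 2) n| * L ^ n.
Proof.
move=> L0.
pose G := [set s : {ffun 'I_p -> 'S_n} | ~~ has_chain L.+1 s].
pose T (s : {ffun 'I_p -> 'S_n}) := [set t : 'S_n |
  [forall x, forall y, dominated s x y ==> (t y < t x)]].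
pose X := [set st : {ffun 'I_p -> 'S_n} * 'S_n | (st.1 \in G) && (st.2 \in T st.1)].
have leX : #|X| <= #|avoiders (idpermmx p.+2 2) n|.
  rewrite -(card_imset (mem X) (@permmx_of_inj n p)).
  apply: subset_leq_card; apply/fintype.subsetP => A /finset.imsetP[[s t] stX ->].
  apply: permmx_of_avoids => x y.
  move: stX; rewrite !inE => /andP[_ /forallP sT].
  by have /forallP/(_ y)/implyP := sT x.
apply: leq_trans (leq_mul leX (leqnn _)).
have -> : #|X| = \sum_(s in G) #|T s|.
  under eq_bigr => s _ do rewrite -sum1_card.
  by rewrite pair_big_dep /= -sum1_card; apply: eq_bigl => st; rewrite inE.
rewrite big_distrl /= -sum_nat_const; apply: leq_sum => s; rewrite inE => nc.
have [h hs] := level_function L0 nc.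
apply: leq_trans (card_level_reversing h) _; rewrite leq_mul2r.
apply/orP; right; apply: subset_leq_card; apply/fintype.subsetP => t.
rewrite !inE => /forallP H; apply/forallP => x; apply/forallP => y.
by apply/implyP => /hs; have /forallP/(_ y)/implyP := H x.
Qed.

Lemma ffact_le_exp (n m : nat) : n ^_ m <= n ^ m.
Proof.
by elim: m => // m IH; rewrite ffactnSr expnSr leq_mul ?leq_subr.
Qed.

(** The additional factor l! turns the binomial coefficient into a falling factorial, which is at
    most n^l. *)
Lemma card_has_chain_exp (n p l : nat) :
  #|[set s : {ffun 'I_p -> 'S_n} | has_chain l s]| * l`! ^ p.+1
    <= n ^ l * n`! ^ p.
Proof.
rewrite expnS mulnCA.
apply: leq_trans (leq_mul (leqnn _) (card_has_chain _ _ _)) _.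
by rewrite mulnA [l`! * _]mulnC bin_ffact leq_mul2r ffact_le_exp orbT.
Qed.

Lemma card_no_chain (n p l : nat) :
  #|[set s : {ffun 'I_p -> 'S_n} | ~~ has_chain l s]|
    + #|[set s : {ffun 'I_p -> 'S_n} | has_chain l s]| = n`! ^ p.
Proof.
have <- : #|{ffun 'I_p -> 'S_n}| = n`! ^ p by rewrite card_ffun card_Sn card_ord.
rewrite addnC -(cardsC [set s : {ffun 'I_p -> 'S_n} | has_chain l s]).
by congr (_ + _); apply: eq_card => s; rewrite !inE.
Qed.

(** * Real estimates and the final bound *)

Local Open Scope ring_scope.

Lemma expR1_ge2 (R : realType) : 2 <= expR 1 :> R.
Proof. exact: expR_ge1Dx. Qed.

(** Induction from equality at l = 1, using (1 + 1/l)^l <= e. The leading factor e is what later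
    yields the fraction 1/e. *)
Lemma stirling_lower (R : realType) (l : nat) : (0 < l)%N ->
  expR 1 * l%:R ^+ l <= l`!%:R * expR 1 ^+ l :> R.
Proof.
case: l => // l _; elim: l => [|l IH]; first by rewrite !expr1 mulr1 mul1r.
have step : l.+2%:R ^+ l.+1 <= expR 1 * l.+1%:R ^+ l.+1 :> R.
  have -> : expR 1 = expR (l.+1%:R^-1) ^+ l.+1 :> R.
    by rewrite -expRM_natr mulVf ?pnatr_eq0.
  rewrite -exprMn lerXn2r ?nnegrE ?mulr_ge0 ?expR_ge0 //.
  have -> : l.+2%:R = (1 + l.+1%:R^-1) * l.+1%:R :> R.
    by rewrite mulrDl mulVf ?pnatr_eq0 // mul1r -natr1.
  by rewrite ler_wpM2r ?expR_ge1Dx.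
rewrite exprS mulrCA factS natrM -mulrA ler_wpM2l //.
apply: le_trans (ler_wpM2l (expR_ge0 1) step) _.
by rewrite [expR 1 ^+ _]exprS [leRHS]mulrCA ler_wpM2l ?expR_ge0.
Qed.

Lemma card_has_chain_le (R : realType) (n p l : nat) :
  (0 < n)%N -> (0 < l)%N -> expR 1 ^+ p.+1 * n%:R <= l%:R ^+ p.+1 :> R ->
  #|[set s : {ffun 'I_p -> 'S_n} | has_chain l s]|%:R * expR 1
    <= n`!%:R ^+ p :> R.
Proof.
move=> n0 l0 le; set b := #|_|; set e := expR 1.
have e0 : 0 < e by apply: expR_gt0.
have e1 : 1 <= e by apply: le_trans (expR1_ge2 R); rewrite ler1n.
have nl0 : 0 < n%:R ^+ l :> R by rewrite exprn_gt0 // ltr0n.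
(* By [stirling_lower], (l!)^k >= e^k (l/e)^(kl) with k = p + 1; here e^k >= e, and (l/e)^k >= n by
   hypothesis. *)
have fact_ge : e * n%:R ^+ l <= l`!%:R ^+ p.+1 :> R.
  rewrite -(ler_pM2r (exprn_gt0 p.+1 (exprn_gt0 l e0))) -exprMn.
  apply: le_trans (_ : (e * l%:R ^+ l) ^+ p.+1 <= _); last first.
    by rewrite lerXn2r ?nnegrE ?mulr_ge0 ?exprn_ge0 ?stirling_lower // ltW.
  rewrite exprMn -mulrA; apply: ler_pM.
  - exact: ltW.
  - by rewrite mulr_ge0 ?exprn_ge0 // ltW.
  - by rewrite ler_eXnr.
  - rewrite -!exprM ![(_ * p.+1)%N]mulnC !exprM mulrC -exprMn.
    by rewrite lerXn2r ?nnegrE ?mulr_ge0 ?exprn_ge0 // ltW.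
have := card_has_chain_exp n p l; rewrite -/b -(ler_nat R) !natrM !natrX => H.
rewrite -(ler_pM2r nl0) -mulrA [leRHS]mulrC.
by apply: le_trans H; rewrite ler_wpM2l.
Qed.

Theorem theorem7p4 (R : realType) (d n : nat) (hd : (2 <= d)%N)
    (hn : (1 <= n)%N) :
  1 / (expR 1 * n%:R) * expR (- (1 + 1 / (d%:R - 1)) * n%:R)
    * (n`!)%:R `^ (d%:R - 1 - 1 / (d%:R - 1))
  <= #|avoiders (idpermmx d 2) n|%:R :> R.
Proof.
case: d hd => [|[|p]] // _.
have -> : p.+2%:R - 1 = p.+1%:R :> R by rewrite -natr1 addrK.
set e : R := expR 1; set N : R := n`!%:R; set k : R := p.+1%:R.
set A : R := #|_|%:R.
have e2 : 2 <= e := expR1_ge2 R.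
have e0 : 0 < e by apply: expR_gt0.
have n1 : 1 <= n%:R :> R by rewrite ler1n.
have n0 : 0 < n%:R :> R by rewrite ltr0n.
have N0 : 0 < N by rewrite ltr0n fact_gt0.
have k0 : k != 0 by rewrite pnatr_eq0.
pose r : R := n%:R `^ k^-1.
have r1 : 1 <= r by rewrite -(powRr0 n%:R) ler_powR // invr_ge0.
have r0 : 0 <= r by apply: le_trans r1.
have rk : r ^+ p.+1 = n%:R.
  by rewrite -powR_mulrn // -powRrM mulVf // powRr1 // ltW.
(* Both sides of the rounding matter: [L.+1] >= e r makes chains of that size rare, and [L] <= e r
   bounds the loss L^n. *)
pose L := Num.truncn (e * r).
have L0 : (0 < L)%N by rewrite truncn_gt0; nra.
have er0 : 0 <= e * r by rewrite mulr_ge0 // ltW.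
have Ler : L%:R <= e * r by rewrite truncn_le.
have Lgt : e * r <= L.+1%:R by rewrite ltW // truncnS_gt.
have few : #|[set s : {ffun 'I_p -> 'S_n} | has_chain L.+1 s]|%:R * e <= N ^+ p.
  by apply: card_has_chain_le => //; rewrite -rk -exprMn lerXn2r ?nnegrE.
have := card_avoiders_ge n p L0; have := card_no_chain n p L.+1.
move: few; set b := #|[set s : {ffun 'I_p -> 'S_n} | has_chain _ _]|.
set g := #|_| => few /(congr1 (fun m => m%:R : R)).
rewrite natrD natrX -/N => gb; rewrite -(ler_nat R) !natrM natrX -/N -/A => main.
have Np0 : 0 < N ^+ p by apply: exprn_gt0.
(* The chain-free fraction is at least 1 - 1/e >= 1/e >= 1/(en), since e >= 2 and n >= 1; this is
   the prefactor of the claim. *)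
have many : N ^+ p / (e * n%:R) <= g%:R.
  rewrite ler_pdivrMr ?mulr_gt0 //.
  apply: (@le_trans _ _ (g%:R * e)); last first.
    by rewrite mulrA ler_peMr // mulr_ge0 // ltW.
  apply: (@le_trans _ _ (N ^+ p * (e - 1))); last by nra.
  by rewrite ler_peMr ?(ltW Np0) //; lra.
(* This is n^n <= n! e^n raised to the power 1/k. *)
have rn : r ^+ n <= N `^ k^-1 * expR (k^-1 * n%:R).
  have -> : r ^+ n = (n%:R ^+ n) `^ k^-1.
    by rewrite -!powR_mulrn // ?powR_ge0 ?(ltW n0) // powRAC.
  have -> : expR (k^-1 * n%:R) = (e ^+ n) `^ k^-1.
    by rewrite -expRM_natr mul1r -expRM mulrC.
  rewrite -powRM ?exprn_ge0 ?(ltW e0) ?(ltW N0) //.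
  apply: ge0_ler_powR; rewrite ?nnegrE ?invr_ge0 ?mulr_ge0 ?exprn_ge0 ?(ltW e0) ?(ltW N0) //.
  apply: le_trans (stirling_lower R hn); rewrite ler_peMl ?exprn_ge0 //.
  by rewrite -/e; lra.
have upper : g%:R * N <= A * (e ^+ n * (N `^ k^-1 * expR (k^-1 * n%:R))).
  apply: le_trans main _; rewrite ler_wpM2l //.
  apply: le_trans (_ : (e * r) ^+ n <= _); first by rewrite lerXn2r ?nnegrE.
  by rewrite exprMn ler_wpM2l // exprn_ge0 // ltW.
rewrite !div1r mulNr expRN powRB; last by rewrite (gt_eqF N0) implybT.
rewrite powR_mulrn ?(ltW N0) // mulrDl mul1r expRD.
have -> : expR n%:R = e ^+ n by rewrite -expRM_natr mul1r.
set M := e ^+ n * (N `^ k^-1 * expR (k^-1 * n%:R)) in upper.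
have M0 : 0 < M by rewrite !mulr_gt0 ?exprn_gt0 ?powR_gt0 ?expR_gt0.
(* [M] collects e^((1+1/k)n) (n!)^(1/k), so the claimed bound is exactly the lower bound in [many]
   times [N / M]. *)
have -> : (e * n%:R)^-1 * (e ^+ n * expR (k^-1 * n%:R))^-1 * (N ^+ p.+1 / N `^ k^-1)
   = N ^+ p / (e * n%:R) * N / M.
  rewrite /M exprS !invfM; ring.
rewrite ler_pdivrMr //; apply: le_trans upper.
by rewrite ler_wpM2r // ltW.
Qed.
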